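(* Assume that for all $z\in\mathcal Z$ and $g\in\mathcal G$ we have $a\le L(z,g)\le b$ for some reals $a,b$. Let $\lambda>0$, $\pi\in\mathcal M$, let $P$ be a probability distribution on $\mathcal Z$ and $Z_1,\dots,Z_n$ i.i.d. with law $P$. Consider the SeqRand algorithm applied with $\delta_\lambda(Z,g,g')=\lambda(b-a)^2/8$ and $\hat\pi(\rho)=\rho$, and let $\hat\mu$ be its randomizing distribution. Then $$\mathbb E_{Z_1^n}\mathbb E_{g\sim\hat\mu}R(g)\le\min_{\rho\in\mathcal M}\Big\{\mathbb E_{g\sim\rho}R(g)+\frac{\lambda(b-a)^2}8+\frac{K(\rho,\pi)}{\lambda(n+1)}\Big\}.$$ In particular, when $\mathcal G$ is finite, by taking $\pi$ uniform on $\mathcal G$ and $\lambda=\sqrt{\frac{8\log|\mathcal G|}{(b-a)^2(n+1)}}$, we get $$\mathbb E_{Z_1^n}\mathbb E_{g\sim\hat\mu}R(g)-\min_{g\in\mathcal G}R(g)\le(b-a)\sqrt{\frac{\log|\mathcal G|}{2(n+1)}}.$$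
   Context: Setting: $\mathcal Z=\mathcal X\times\mathcal Y$; a prediction function is a measurable map $\mathcal X\to\mathcal Y$; $\mathcal G$ is a measurable space of prediction functions and $\mathcal M$ the set of probability distributions on $\mathcal G$. $L(z,g)\in\mathbb R$ is the loss of $g$ on $z\in\mathcal Z$ and $R(g)=\mathbb E_{Z\sim P}L(Z,g)$. All quantities are implicitly assumed measurable. $K(\rho,\pi)=\mathbb E_{g\sim\rho}\log\frac{d\rho}{d\pi}(g)$ if $\rho\ll\pi$, and $+\infty$ otherwise. For measurable $h:\mathcal G\to\mathbb R$, $\pi_{-h}(dg)=\frac{e^{-h(g)}}{\mathbb E_{g'\sim\pi}e^{-h(g')}}\pi(dg)$. SeqRand algorithm in this case: set $S_0\equiv0$, draw $\hat g_0$ from $\pi$. For $i=1,\dots,n$ define $S_i(g)=S_{i-1}(g)+L(Z_i,g)+\lambda(b-a)^2/8$ for $g\in\mathcal G$, and draw $\hat g_i$ from $\pi_{-\lambda S_i}$. Output a function drawn uniformly from $\{\hat g_0,\dots,\hat g_n\}$. Conditionally on $Z_1^n=(Z_1,\dots,Z_n)$, the distribution of the output function is denoted $\hat\mu$. *)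

(* Defs.v *)
From HB Require Import structures.
From mathcomp Require Import all_boot all_order all_algebra.
From mathcomp Require Import finmap all_classical all_reals all_analysis.
From mathcomp Require Import measurable_realfun.

Set Implicit Arguments.
Unset Strict Implicit.
Unset Printing Implicit Defensive.

Import Order.TTheory GRing.Theory Num.Def Num.Theory.
Import numFieldNormedType.Exports.

Local Open Scope classical_set_scope.
Local Open Scope ring_scope.
Local Open Scope ereal_scope.

(* The law of [X] is compared with [P] on measurable sets only: the value of a
   measure outside its sigma-algebra is meaningless. *)
Definition has_law d d' (T : measurableType d) (T' : measurableType d')
    (R : realType) (Pr : probability T R) (X : {mfun T >-> T'})
    (P : probability T' R) : Prop :=
  forall A : set T', measurable A -> distribution Pr X A = P A.

Definition mutually_independent d d' (T : measurableType d)
    (T' : measurableType d') (R : realType) (Pr : probability T R) (n : nat)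
    (X : 'I_n -> {mfun T >-> T'}) : Prop :=
  forall (J : {set 'I_n}) (A : 'I_n -> set T'),
    (forall i, measurable (A i)) ->
    Pr (\bigcap_(i in [set` J]) X i @^-1` A i) =
      \prod_(i in J) Pr (X i @^-1` A i).

(* [lne 0 = -oo] does no harm: the derivative is positive [rho]-a.e. *)
Definition KL d (T : measurableType d) (R : realType)
    (rho pi : probability T R) : \bar R :=
  if `[< rho `<< pi >] then
    \int[rho]_x lne (Radon_Nikodym (charge_of_finite_measure rho) pi x)
  else +oo.

Section gibbs.
Context d (T : measurableType d) (R : realType).
Variables (pi : probability T R) (h : {mfun T >-> R}).

Definition exp_weight (A : set T) : \bar R :=
  \int[pi]_(x in A) (expR (- h x))%:E.

Let exp_weight0 : exp_weight set0 = 0.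
Proof. by rewrite /exp_weight integral_set0. Qed.

Let exp_weight_ge0 A : 0 <= exp_weight A.
Proof. by apply: integral_ge0 => x _; rewrite lee_fin expR_ge0. Qed.

Let exp_weight_sigma_additive : semi_sigma_additive exp_weight.
Proof.
apply: semi_sigma_additive_nng_induced => [|x]; last exact: expR_ge0.
apply/measurable_EFinP; apply: measurableT_comp => //.
exact: measurableT_comp.
Qed.

HB.instance Definition _ := isMeasure.Build _ _ _ exp_weight
  exp_weight0 exp_weight_ge0 exp_weight_sigma_additive.

(* [mnormalize] divides by the total mass E_pi exp(-h); its fallback value [pi]
   is used only if this mass is infinite, hence never for a bounded [h]. *)
Definition gibbs : probability T R := mnormalize exp_weight pi.

End gibbs.

Section independent_draws.
Context d (T : measurableType d) (R : realType).

Definition cons_pair n (p : T * n.-tuple T) : n.+1.-tuple T :=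
  [the n.+1.-tuple T of p.1 :: p.2].

Let measurable_cons_pair n : measurable_fun setT (@cons_pair n).
Proof. exact: measurable_cons. Qed.

HB.instance Definition _ n :=
  isMeasurableFun.Build _ _ _ _ (@cons_pair n) (@measurable_cons_pair n).

(* law of (g_0, ..., g_(n-1)) for independent draws g_i from [q i] *)
Fixpoint draws (n : nat) (q : nat -> probability T R) :
    probability (n.-tuple T) R :=
  match n with
  | 0 => \d_([tuple])
  | m.+1 => distribution (q 0%N \x draws m (fun i => q i.+1)) (@cons_pair m)
  end.

End independent_draws.

Section uniform_choice.
Context d (T : measurableType d) (R : realType) (n : nat).

(* law of [tnth t I] with [I] uniform on {0, ..., n}: repeated entries of [t]
   count with their multiplicity *)
Definition uniform_choice (t : n.+1.-tuple T) : set T -> \bar R :=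
  mscale ((n.+1%:R^-1)%:nng)%R (msum (fun i => \d_(nth point t i)) n.+1).

HB.instance Definition _ t := Measure.on (uniform_choice t).

Let uniform_choiceE t A :
  uniform_choice t A = (n.+1%:R^-1)%R%:E * \sum_(i < n.+1) \d_(tnth t i) A.
Proof.
rewrite /uniform_choice /mscale/= /msum; congr (_ * _).
by apply: eq_bigr => i _; rewrite -tnth_nth.
Qed.

Lemma measurable_uniform_choice A : measurable A ->
  measurable_fun setT (uniform_choice ^~ A).
Proof.
move=> mA; under eq_fun do rewrite uniform_choiceE.
apply: measurable_funeM; apply: emeasurable_sum => i.
have -> : (fun t : n.+1.-tuple T => \d_(tnth t i) A : \bar R) =
    (fun x => \d_x A) \o (fun t => tnth t i) by [].
apply: measurableT_comp; last exact: measurable_tnth.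
exact: measurable_fun_dirac.
Qed.

Lemma uniform_choiceT t : uniform_choice t setT = 1.
Proof.
rewrite uniform_choiceE.
under eq_bigr do rewrite diracT.
rewrite sumEFin sumr_const card_ord -EFinM -mulr_natr mul1r mulVf//.
Qed.

Variable D : probability (n.+1.-tuple T) R.

(* law of a uniformly chosen entry of a random tuple of law [D] *)
Definition output_law (A : set T) : \bar R := \int[D]_t uniform_choice t A.

Let output_law0 : output_law set0 = 0.
Proof. by rewrite /output_law integral0_eq// => t _; rewrite measure0. Qed.

Let output_law_ge0 A : 0 <= output_law A.
Proof. exact: integral_ge0. Qed.

Let output_law_sigma_additive : semi_sigma_additive output_law.
Proof.
move=> F mF tF mUF; rewrite [X in _ --> X](_ : _ =
  \int[D]_t (\sum_(k <oo) uniform_choice t (F k))); last first.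
  apply: eq_integral => t _.
  by apply/esym/cvg_lim => //; exact/measure_semi_sigma_additive.
apply/cvg_closeP; split.
  by apply: is_cvg_nneseries => k _ _; exact: integral_ge0.
rewrite closeE// integral_nneseries// => k.
exact: measurable_uniform_choice.
Qed.

HB.instance Definition _ := isMeasure.Build _ _ _ output_law
  output_law0 output_law_ge0 output_law_sigma_additive.

Let output_lawT : output_law setT = 1.
Proof.
rewrite /output_law; under eq_integral do rewrite uniform_choiceT.
by rewrite integral_cst// mul1e; exact: probability_setT.
Qed.

HB.instance Definition _ :=
  Measure_isProbability.Build _ _ _ output_law output_lawT.

End uniform_choice.

Section SeqRand.
Context dZ dG (Z : measurableType dZ) (G : measurableType dG) (R : realType).
Variable L : {mfun (Z * G)%type >-> R}.

Definition loss_at (z : Z) (g : G) : R := L (z, g).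

Let measurable_loss_at z : measurable_fun setT (loss_at z).
Proof. exact: measurableT_comp. Qed.

HB.instance Definition _ z :=
  isMeasurableFun.Build _ _ _ _ (loss_at z) (@measurable_loss_at z).

Definition risk (P : probability Z R) (g : G) : \bar R :=
  'E_P[fun z => L (z, g)].

Variables (lambda delta : R) (pi : probability G R).

(* S_i, where [zs] lists Z_1, Z_2, ... and [delta] is the value of the
   (constant) function delta_lambda *)
Definition cumulative (zs : seq Z) (i : nat) : {mfun G >-> R} :=
  foldl (fun (S : {mfun G >-> R}) z => S + loss_at z + cst delta)%R
        (cst 0%R) (take i zs).

(* pi_{- lambda S_i} *)
Definition posterior (zs : seq Z) (i : nat) : probability G R :=
  gibbs pi (cst lambda * cumulative zs i)%R.

(* muhat given Z_1^n = [zs]. As [delta] does not involve the past draws, the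
   successive draws g_0, ..., g_n are independent given the data; the law of
   g_0 is [posterior zs 0], which is [pi] because S_0 = 0. *)
Definition seqrand (n : nat) (zs : n.-tuple Z) : probability G R :=
  output_law (draws n.+1 (posterior zs)).

End SeqRand.

(* For finite [T]; the fallback argument of [mnormalize] is then unused. *)
Definition uniform_on d (T : measurableType d) (R : realType) :
    probability T R :=
  mnormalize (@counting T R) \d_(@point T).

(* Main.v *)
(** Put [Phi S := - ln (E_pi (expR (- lambda S))) / lambda].  For [g] drawn from
    [pi_(- lambda S)], Hoeffding's lemma gives
    [E L(z, g) <= Phi (S + L(z, .) + delta) - Phi S] for every [z].  Since [S_i] does
    not depend on [Z_(i+1)], averaging over [z] bounds the expected risk of the draw
    number [i] by [E (Phi S_(i+1) - Phi S_i)]; the sum over [i <= n] telescopes to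
    [E (Phi S_(n+1))].  By the variational formula
    [Phi S <= E_rho S + K(rho, pi) / lambda], and [E_rho S_(n+1)] averages to
    [(n + 1) (E_rho R + delta)].  The bound is minimal at
    [rho = pi_(- lambda (n + 1) R)], where its value is
    [delta - ln (E_pi (expR (- lambda (n + 1) R))) / (lambda (n + 1))]. *)

Require Import Defs.
From HB Require Import structures.
From mathcomp Require Import all_boot all_order all_algebra.
From mathcomp Require Import finmap all_classical all_reals all_analysis.
From mathcomp Require Import measurable_realfun ring lra.

Set Implicit Arguments.
Unset Strict Implicit.
Unset Printing Implicit Defensive.

Import Order.TTheory GRing.Theory Num.Def Num.Theory.
Import numFieldNormedType.Exports.

Local Open Scope classical_set_scope.
Local Open Scope ring_scope.

(** * Hoeffding's lemma for two-point laws *)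

(** There are [n + 1] posteriors but only [n] observations. Matching the last posterior with an
    increment of [Phi] takes one more observation, which exists only as an integration variable
    under [P]. The telescoping is therefore an induction on the sample size that peels off the first
    observation and keeps the initial potential [S] arbitrary; its base case is the single step with
    the fictitious observation. The algorithm is compared with one [rho] only, the minimizer of the
    bound. Its divergence from [pi] is finite, so the regret argument stays in the reals; for other
    [rho] the divergence may be infinite and is only bounded from below. In the finite case
    singletons need not be measurable, so the partition function is estimated through level sets of
    the risk. There [lambda] is [0] when [a = b] or [G] has one element, and constant risk is
    treated apart for this reason. *)

Section hoeffding_scalar.
Context (R : realType).

(** Convexity: the tangent at [u * x] is evaluated at [u] and at [0], and with weights [x] and
    [1 - x] the first-order terms cancel. *)
Lemma expR_chord (u x : R) : 0 <= x <= 1 -> expR (u * x) <= 1 - x + x * expR u.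
Proof.
move=> /andP[x0 x1].
have H v : (1 + (v - u * x)) * expR (u * x) <= expR v.
  rewrite -[in leRHS](subrK (u * x) v) expRD ler_wpM2r ?expR_ge0//.
  exact: expR_ge1Dx.
have := ler_wpM2l x0 (H u).
have : 0 <= 1 - x by lra.
move=> /ler_wpM2l/(_ _ _ (H 0)); rewrite expR0; lra.
Qed.

Variable p : R.
Hypothesis p01 : 0 <= p <= 1.

Let D_gt0 u : 0 < 1 - p + p * expR u.
Proof.
have /andP[p0 p1] := p01; have e := expR_gt0 u.
case: (ltrgtP p 1) p1 => // [pl _|-> _]; last by lra.
have := mulr_ge0 p0 (ltW e); lra.
Qed.

(** The expression is the derivative of [f] in [bernoulli_mgf_le]. It vanishes at [0], so it is
    enough that it is nondecreasing. *)
Let slope_ge0 (u : R) : 0 <= u ->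
  0 <= p + u / 4 - p * expR u / (1 - p + p * expR u).
Proof.
move=> u0.
(* Writing [p * expR u] as the denominator minus [1 - p] leaves a single occurrence of the
   exponential. *)
pose k (u : R) : R := u / 4 + p - 1 + (1 - p) * (1 - p + p * expR u)^-1.
have dk (v : R) : is_derive v 1 k
    (4^-1 - (1 - p) * (p * expR v) / (1 - p + p * expR v) ^+ 2).
  have Dv := D_gt0 v.
  have Dv0 : 1 - p + p * expR v != 0 by rewrite gt_eqF.
  rewrite /k; apply: is_derive_eq.
  rewrite /GRing.scale/=.
  rewrite ?mulr0 ?addr0 ?add0r ?mul0r ?mulr1.
  by field.
have -> : p + u / 4 - p * expR u / (1 - p + p * expR u) = k u - k 0.
  by rewrite /k expR0; field; rewrite subrK oner_eq0 gt_eqF.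
rewrite subr_ge0; apply: (@ger0_derive1_ndecry R k 0) => //.
- move=> x _; rewrite derive1E; have [_ ->] := dk x.
  rewrite subr_ge0 ler_pdivrMr ?exprn_gt0//.
  (* With [y = p * expR x] this is [4 (1 - p) y <= (1 - p + y)^2]: a law on [{0, 1}] has variance at
     most [1/4], the source of the constant [1/8]. *)
  have := sqr_ge0 (1 - p - p * expR x); lra.
- apply: continuous_subspaceT => x; apply/differentiable_continuous.
  by apply/derivable1_diffP; case: (dk x).
Qed.

(** The logarithm of the quotient of the two sides vanishes at [0] and has nonnegative slope. *)
Lemma bernoulli_mgf_le (u : R) : 0 <= u ->
  1 - p + p * expR u <= expR (p * u + u ^+ 2 / 8).
Proof.
move=> u0.
pose f (u : R) : R := p * u + u ^+ 2 / 8 - ln (1 - p + p * expR u).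
have df (v : R) : is_derive v 1 f
    (p + v / 4 - p * expR v / (1 - p + p * expR v)).
  have Dv := D_gt0 v.
  rewrite /f.
  have dln : is_derive v 1 (fun v => ln (1 - p + p * expR v))
      ((1 - p + p * expR v)^-1 * (p * expR v)).
    apply: (@is_derive1_comp R (@ln R) (fun v => 1 - p + p * expR v)).
      exact: is_derive1_ln.
    by apply: is_derive_eq; rewrite add0r mul1r.
  apply: is_derive_eq.
  rewrite /GRing.scale/= ?mulr0 ?addr0 ?add0r ?mul0r ?mulr1.
  have Dv0 : 1 - p + p * expR v != 0 by rewrite gt_eqF.
  by field.
rewrite -[leLHS]lnK; last by rewrite posrE D_gt0.
rewrite ler_expR -subr_ge0.
have <- : f 0 = 0 by rewrite /f expR0 mulr1 subrK ln1 expr0n/= !(mul0r,mulr0) addr0 subr0.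
apply: (@ger0_derive1_ndecry R f 0) => //.
- move=> x; rewrite in_itv/= andbT => x0.
  rewrite derive1E; have [_ ->] := df x.
  exact/slope_ge0/ltW.
- apply: continuous_subspaceT => x; apply/differentiable_continuous.
  by apply/derivable1_diffP; case: (df x).
Qed.

End hoeffding_scalar.

(** * Integrals of bounded measurable functions *)

Section bounded_measurable.
Context d (T : measurableType d) (R : realType).
Implicit Types (f g : T -> R).

Variable mu : probability T R.

(** Such functions are integrable for every probability law and stable under the operations used
    below, partial integration included. Side conditions of linearity, monotonicity and Fubini thus
    become closure rules, and integrals can be computed in the reals. *)
Definition bounded_measurable f :=
  measurable_fun setT f /\ exists M, forall x, `|f x| <= M.

Lemma bounded_measurable_cst (c : R) : bounded_measurable (fun=> c).
Proof. by split; [exact: measurable_cst|exists `|c|]. Qed.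

Lemma bounded_measurableD f g : bounded_measurable f -> bounded_measurable g ->
  bounded_measurable (fun x => f x + g x).
Proof.
move=> [mf [M fM]] [mg [N gN]]; split; first exact: measurable_funD.
by exists (M + N) => x; rewrite (le_trans (ler_normD _ _))// lerD.
Qed.

Lemma bounded_measurableN f : bounded_measurable f ->
  bounded_measurable (fun x => - f x).
Proof.
move=> [mf [M fM]]; split; first exact: measurableT_comp.
by exists M => x; rewrite normrN.
Qed.

Lemma bounded_measurableB f g : bounded_measurable f -> bounded_measurable g ->
  bounded_measurable (fun x => f x - g x).
Proof. by move=> ? ?; apply: bounded_measurableD => //; exact: bounded_measurableN. Qed.

Lemma bounded_measurableM f g : bounded_measurable f -> bounded_measurable g ->
  bounded_measurable (fun x => f x * g x).
Proof.
move=> [mf [M fM]] [mg [N gN]]; split; first exact: measurable_funM.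
by exists (M * N) => x; rewrite normrM ler_pM.
Qed.

Lemma bounded_measurableZ c f : bounded_measurable f ->
  bounded_measurable (fun x => c * f x).
Proof. exact/bounded_measurableM/bounded_measurable_cst. Qed.

Lemma bounded_measurable_sum n (f : 'I_n -> T -> R) :
  (forall i, bounded_measurable (f i)) ->
  bounded_measurable (fun x => \sum_(i < n) f i x).
Proof.
elim: n f => [|n IH] f bf.
  by under eq_fun do rewrite big_ord0; exact: bounded_measurable_cst.
under eq_fun do rewrite big_ord_recl.
by apply: bounded_measurableD => //; exact: IH.
Qed.

Lemma bounded_measurable_itv f a b : measurable_fun setT f ->
  (forall x, a <= f x <= b) -> bounded_measurable f.
Proof.
move=> mf fab; split=> //; exists (`|a| + `|b|) => x.
have /andP[ax xb] := fab x; rewrite ler_norml; apply/andP; split.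
  rewrite lerNl (le_trans (y := `|a|)) ?lerDl// -(opprK a) normrN.
  by rewrite (le_trans _ (ler_norm _))// lerN2.
by rewrite (le_trans xb)// (le_trans (ler_norm _))// lerDr.
Qed.

Lemma bounded_measurable_expR f : bounded_measurable f ->
  bounded_measurable (fun x => expR (f x)).
Proof.
move=> [mf [M fM]]; apply: (@bounded_measurable_itv _ 0 (expR M)).
  exact: measurableT_comp.
by move=> x; rewrite expR_ge0 ler_expR (le_trans (ler_norm _)).
Qed.

Lemma bounded_measurable_ln f (m : R) : 0 < m -> (forall x, m <= f x) ->
  bounded_measurable f -> bounded_measurable (fun x => ln (f x)).
Proof.
move=> m0 mf [mef [M fM]]; apply: (@bounded_measurable_itv _ (ln m) (ln M)).
  by apply: measurableT_comp => //; exact: measurable_ln.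
move=> x; have fx0 : 0 < f x := lt_le_trans m0 (mf x).
have fxM : f x <= M by rewrite (le_trans (ler_norm _)).
by rewrite !ler_ln ?posrE// ?mf// (lt_le_trans fx0).
Qed.

Lemma bounded_measurable_integrable f : bounded_measurable f ->
  mu.-integrable setT (EFin \o f).
Proof.
move=> [mf [M fM]]; apply: measurable_bounded_integrable => //.
  by rewrite (le_lt_trans (probability_le1 _ _))// ltry.
exists M; split; first exact: num_real.
by move=> y My x _; apply: (le_trans (fM x)); exact: ltW.
Qed.

Lemma EFin_Rintegral f : bounded_measurable f ->
  (\int[mu]_x (f x)%:E)%E = (\int[mu]_x f x)%:E.
Proof.
by move=> bf; rewrite fineK//; exact/integrable_fin_num/bounded_measurable_integrable.
Qed.

Lemma bRintegralD f g : bounded_measurable f -> bounded_measurable g ->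
  \int[mu]_x (f x + g x) = \int[mu]_x f x + \int[mu]_x g x.
Proof. by move=> ? ?; rewrite RintegralD//; exact: bounded_measurable_integrable. Qed.

Lemma bRintegralB f g : bounded_measurable f -> bounded_measurable g ->
  \int[mu]_x (f x - g x) = \int[mu]_x f x - \int[mu]_x g x.
Proof. by move=> ? ?; rewrite RintegralB//; exact: bounded_measurable_integrable. Qed.

Lemma bRintegralZ c f : bounded_measurable f ->
  \int[mu]_x (c * f x) = c * \int[mu]_x f x.
Proof. by move=> ?; rewrite RintegralZl//; exact: bounded_measurable_integrable. Qed.

Lemma bRintegral_cst c : \int[mu]_x c = c.
Proof. by rewrite Rintegral_cst// [X in fine X](probability_setT mu)/= mulr1. Qed.

Lemma bRintegral_le f g : bounded_measurable f -> bounded_measurable g ->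
  (forall x, f x <= g x) -> \int[mu]_x f x <= \int[mu]_x g x.
Proof.
by move=> ? ? ?; apply: le_Rintegral => //; exact: bounded_measurable_integrable.
Qed.

Lemma bRintegral_itv f a b : measurable_fun setT f ->
  (forall x, a <= f x <= b) -> a <= \int[mu]_x f x <= b.
Proof.
move=> mf fab; have bf := bounded_measurable_itv mf fab.
rewrite -{1}(bRintegral_cst a) -(bRintegral_cst b).
by apply/andP; split; apply: bRintegral_le => //;
  do ?exact: bounded_measurable_cst; move=> x; have /andP[] := fab x.
Qed.

End bounded_measurable.

Section bounded_measurable_comp.
Context d1 d2 (T1 : measurableType d1) (T2 : measurableType d2) (R : realType).

Lemma bounded_measurable_comp (phi : T1 -> T2) (f : T2 -> R) :
  measurable_fun setT phi -> bounded_measurable f ->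
  bounded_measurable (f \o phi).
Proof.
by move=> mphi [mf [M fM]]; split; [exact: measurableT_comp|exists M => x /=].
Qed.

Lemma bRintegral_distribution (m1 : probability T1 R) (X : {mfun T1 >-> T2})
    (f : T2 -> R) :
  bounded_measurable f ->
  \int[distribution m1 X]_y f y = \int[m1]_x f (X x).
Proof.
move=> bf; rewrite /Rintegral integral_distribution//.
  by apply/measurable_EFinP; case: bf.
apply: (@bounded_measurable_integrable _ _ _ m1 (f \o X)).
exact: bounded_measurable_comp.
Qed.

End bounded_measurable_comp.

Section bounded_measurable_fubini.
Context d1 d2 (T1 : measurableType d1) (T2 : measurableType d2) (R : realType).
Variable f : T1 * T2 -> R.
Hypothesis bf : bounded_measurable f.

Lemma bounded_measurable_pair1 x : bounded_measurable (fun y => f (x, y)).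
Proof. exact: (bounded_measurable_comp (phi := pair x)). Qed.

Lemma bounded_measurable_pair2 y : bounded_measurable (fun x => f (x, y)).
Proof. exact: (bounded_measurable_comp (phi := pair^~ y)). Qed.

Let bf_integrable (m1 : probability T1 R) (m2 : probability T2 R) :
  (m1 \x m2)%E.-integrable setT (EFin \o f).
Proof. exact: bounded_measurable_integrable. Qed.

Lemma bRintegral_fubini1 (m1 : probability T1 R) (m2 : probability T2 R) :
  \int[(m1 \x m2)%E]_z f z = \int[m1]_x \int[m2]_y f (x, y).
Proof.
rewrite /Rintegral -(integral12_prod_meas1 (bf_integrable m1 m2)); congr fine.
apply: eq_integral => x _; rewrite -EFin_Rintegral//.
exact: bounded_measurable_pair1.
Qed.

Lemma bRintegral_fubini (m1 : probability T1 R) (m2 : probability T2 R) :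
  \int[m1]_x \int[m2]_y f (x, y) = \int[m2]_y \int[m1]_x f (x, y).
Proof.
rewrite -bRintegral_fubini1 /Rintegral.
rewrite -(integral21_prod_meas1 (bf_integrable m1 m2)); congr fine.
apply: eq_integral => y _; rewrite -EFin_Rintegral//.
exact: bounded_measurable_pair2.
Qed.

Lemma bounded_measurable_Rintegral1 (m2 : probability T2 R) :
  bounded_measurable (fun x => \int[m2]_y f (x, y)).
Proof.
(* An arbitrary law on the first factor: the measurability of partial integrals is read off Fubini,
   which asks for integrability on a product. *)
have m1 : probability T1 R := \d_point.
split; last first.
  have [mf [M fM]] := bf; exists M => x.
  rewrite ler_norml; apply: bRintegral_itv; first by case: (bounded_measurable_pair1 x).
  by move=> y; rewrite -ler_norml.
apply/measurable_EFinP.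
rewrite (_ : _ \o _ = fubini_F m2 (EFin \o f)).
  exact: (measurable_fubini_F (bf_integrable m1 m2)).
apply/funext => x /=; rewrite -EFin_Rintegral//.
exact: bounded_measurable_pair1.
Qed.

End bounded_measurable_fubini.

(** * Hoeffding's lemma for bounded functions *)

Section hoeffding.
Context d (T : measurableType d) (R : realType) (mu : probability T R).
Variables (f : T -> R) (a b : R).
Hypotheses (mf : measurable_fun setT f) (fab : forall x, a <= f x <= b).

Lemma hoeffding_mgf (lambda : R) : 0 <= lambda ->
  \int[mu]_x expR (- (lambda * f x)) <=
  expR (- (lambda * \int[mu]_x f x) + lambda ^+ 2 * (b - a) ^+ 2 / 8).
Proof.
move=> l0; have bf := bounded_measurable_itv mf fab.
have ab : a <= b by have /andP[] := fab point; exact: le_trans.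
have [ba|ba] := eqVneq a b.
  have fE x : f x = a by have := fab x; rewrite -ba => /le_anti.
  under eq_Rintegral do rewrite fE.
  under [in leRHS]eq_Rintegral do rewrite fE.
  by rewrite !bRintegral_cst ba subrr expr0n/= mulr0 mul0r addr0.
have ba0 : 0 < b - a by rewrite subr_gt0 lt_neqAle ba.
(* After the reflection [(b - f x) / (b - a)] the exponent is, up to a constant, [u] times a
   variable in [[0, 1]] with [u >= 0], as [bernoulli_mgf_le] requires; [p] is the mean of that
   variable. *)
pose p := (b - \int[mu]_x f x) / (b - a).
have p01 : 0 <= p <= 1.
  have /andP[am mb] := bRintegral_itv mu mf fab.
  by rewrite divr_ge0 ?subr_ge0//= ler_pdivrMr// mul1r lerD2l lerN2.
pose u := lambda * (b - a).
have u0 : 0 <= u by rewrite mulr_ge0// ltW.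
have chord x : expR (- (lambda * f x)) <=
    expR (- (lambda * b)) * (1 + (expR u - 1) / (b - a) * (b - f x)).
  have -> : - (lambda * f x) = - (lambda * b) + u * ((b - f x) / (b - a)).
    by rewrite /u; field; rewrite gt_eqF.
  rewrite expRD ler_wpM2l ?expR_ge0//.
  have fx01 : 0 <= (b - f x) / (b - a) <= 1.
    have /andP[am mb] := fab x.
    by rewrite divr_ge0 ?subr_ge0//= ler_pdivrMr// mul1r lerD2l lerN2.
  rewrite (le_trans (expR_chord u fx01))// le_eqVlt; apply/orP; left; apply/eqP.
  by field; rewrite gt_eqF.
apply: (@le_trans _ _ (expR (- (lambda * b)) * (1 - p + p * expR u))).
  have bfb : bounded_measurable (fun x => (expR u - 1) / (b - a) * (b - f x)).
    by apply/bounded_measurableZ/bounded_measurableB => //; exact: bounded_measurable_cst.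
  apply: (@le_trans _ _ (\int[mu]_x (expR (- (lambda * b)) *
      (1 + (expR u - 1) / (b - a) * (b - f x))))).
    apply: bRintegral_le => //.
      exact/bounded_measurable_expR/bounded_measurableN/bounded_measurableZ.
    by apply/bounded_measurableZ/bounded_measurableD => //; exact: bounded_measurable_cst.
  rewrite bRintegralZ; last first.
    by apply: bounded_measurableD => //; exact: bounded_measurable_cst.
  rewrite bRintegralD//; last exact: bounded_measurable_cst.
  rewrite bRintegralZ; last first.
    by apply: bounded_measurableB => //; exact: bounded_measurable_cst.
  rewrite bRintegralB//; last exact: bounded_measurable_cst.
  rewrite !bRintegral_cst ler_wpM2l ?expR_ge0// /p.
  by rewrite le_eqVlt; apply/orP; left; apply/eqP; field; rewrite gt_eqF.
apply: (@le_trans _ _ (expR (- (lambda * b)) * expR (p * u + u ^+ 2 / 8))).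
  by rewrite ler_wpM2l ?expR_ge0// bernoulli_mgf_le.
rewrite -expRD ler_expR /p /u le_eqVlt; apply/orP; left; apply/eqP.
by field; rewrite gt_eqF.
Qed.

End hoeffding.

(** * Gibbs measures and the variational formula *)

Section gibbs_density.
Context d (T : measurableType d) (R : realType) (pi : probability T R).
Variable h : {mfun T >-> R}.
Hypothesis bh : bounded_measurable h.

Definition partition_function : R := \int[pi]_x expR (- h x).
Local Notation W := partition_function.

Let bexp : bounded_measurable (fun x => expR (- h x)).
Proof. exact/bounded_measurable_expR/bounded_measurableN. Qed.

Lemma partition_function_gt0 : 0 < W.
Proof.
have [mh [M hM]] := bh.
apply: (@lt_le_trans _ _ (expR (- M))); first exact: expR_gt0.
rewrite -[leLHS](bRintegral_cst pi); apply: bRintegral_le => //.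
  exact: bounded_measurable_cst.
by move=> x; rewrite ler_expR lerN2 (le_trans (ler_norm _)).
Qed.
Let W0 := partition_function_gt0.

Let W_neq0 : W != 0. Proof. by rewrite gt_eqF. Qed.

Lemma gibbsE A : measurable A ->
  gibbs pi h A = (\int[pi]_(x in A) (W^-1 * expR (- h x))%:E)%E.
Proof.
move=> mA.
have eT : exp_weight pi h setT = W%:E by rewrite /exp_weight EFin_Rintegral.
transitivity (exp_weight pi h A * (W^-1)%:E)%E.
  change (mnormalize (exp_weight pi h) pi A =
    (exp_weight pi h A * (W^-1)%:E)%E).
  rewrite /mnormalize [X in (X == _) || _]eT [X in _ || (X == _)]eT.
  by rewrite eqe (negbTE W_neq0)/= [X in fine X]eT.
rewrite muleC /exp_weight; under [RHS]eq_integral do rewrite EFinM.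
rewrite integralZl//.
apply: (integrableS measurableT) => //.
exact: bounded_measurable_integrable.
Qed.

Lemma gibbs_dominated : gibbs pi h `<< pi.
Proof.
apply/null_content_dominatesP => A mA A0; rewrite gibbsE//.
apply: null_set_integral => //; apply/measurable_EFinP/measurable_funTS.
by case: (bounded_measurableZ W^-1 bexp).
Qed.

Lemma ae_eq_Radon_Nikodym_gibbs :
  ae_eq pi setT (Radon_Nikodym (charge_of_finite_measure (gibbs pi h)) pi)
    (fun x => (W^-1 * expR (- h x))%:E).
Proof.
apply: integral_ae_eq => //.
- exact/Radon_Nikodym_integrable/gibbs_dominated.
- by apply/measurable_EFinP; case: (bounded_measurableZ W^-1 bexp).
- move=> A _ mA; rewrite -Radon_Nikodym_integral//; last exact: gibbs_dominated.
  exact: gibbsE.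
Qed.

Lemma Rintegral_gibbs (f : T -> R) : bounded_measurable f ->
  \int[gibbs pi h]_x f x = W^-1 * \int[pi]_x (f x * expR (- h x)).
Proof.
move=> bf; rewrite /Rintegral.
have bfe : bounded_measurable (fun x => W^-1 * (f x * expR (- h x))).
  exact/bounded_measurableZ/bounded_measurableM.
rewrite -(Radon_Nikodym_change_of_variables gibbs_dominated)//; last first.
  exact: bounded_measurable_integrable.
rewrite -bRintegralZ; last exact: bounded_measurableM.
rewrite /Rintegral; congr fine; apply: ae_eq_integral => //.
- apply: emeasurable_funM; first by apply/measurable_EFinP; case: bf.
  exact/(measurable_int pi)/Radon_Nikodym_integrable/gibbs_dominated.
- by apply/measurable_EFinP; case: bfe.
- apply: filterS ae_eq_Radon_Nikodym_gibbs => x/= /(_ I) ->.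
  by move=> _; rewrite -EFinM mulrCA.
Qed.

End gibbs_density.

(** Positive and negative parts are compared separately, so no integrability is asked: the
    log-density to which this is applied need not be integrable. *)
Lemma le_integral_ae d (T : measurableType d) (R : realType)
    (mu : {measure set T -> \bar R}) (f g : T -> \bar R) :
  measurable_fun setT f -> measurable_fun setT g ->
  {ae mu, forall x, (f x <= g x)%E} ->
  (\int[mu]_x f x <= \int[mu]_x g x)%E.
Proof.
move=> mf mg fg; rewrite integralE [leRHS]integralE leeB//.
- apply: ae_ge0_le_integral => //; [exact: measurable_funepos..|].
  by apply: filterS fg => x fgx _; rewrite !funeposE ge_max !le_max fgx lexx orbT.
- apply: ae_ge0_le_integral => //; [exact: measurable_funeneg..|].
  by apply: filterS fg => x fgx _; rewrite !funenegE ge_max !le_max leeN2 fgx lexx orbT.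
Qed.

Lemma measurable_lne (R : realType) : measurable_fun setT (@lne R).
Proof.
rewrite (_ : @lne R = fun x => if (x <= 0)%E then -oo%E else er_map (@ln R) x).
  apply: measurable_fun_ifT => //; last first.
    by exact: (@measurable_er_map _ (R : measurableType _) R _ (@measurable_ln R)).
  exact: measurable_fun_lee.
by apply/funext => -[r| |]; rewrite ?lee_fin ?leye_eq ?leNye.
Qed.

Section KL_variational.
Context d (T : measurableType d) (R : realType) (pi : probability T R).
Variable h : {mfun T >-> R}.
Hypothesis bh : bounded_measurable h.
Local Notation W := (partition_function pi h).

Let bexp : bounded_measurable (fun x => expR (- h x)).
Proof. exact/bounded_measurable_expR/bounded_measurableN. Qed.

Lemma KL_gibbs :
  KL (gibbs pi h) pi = (- ln W - \int[gibbs pi h]_x h x)%:E.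
Proof.
have W0 := partition_function_gt0 pi bh.
rewrite /KL asboolT; last exact: gibbs_dominated.
have bl : bounded_measurable (fun x => - ln W - h x).
  by apply: bounded_measurableB => //; exact: bounded_measurable_cst.
transitivity (\int[gibbs pi h]_x (- ln W - h x)%:E)%E; last first.
  rewrite EFin_Rintegral// bRintegralB//; last exact: bounded_measurable_cst.
  by rewrite bRintegral_cst.
apply: ae_eq_integral => //.
- apply: measurableT_comp; first exact: measurable_lne.
  exact/(measurable_int pi)/Radon_Nikodym_integrable/gibbs_dominated.
- by apply/measurable_EFinP; case: bl.
(* The density formula holds [pi]-a.e.; domination carries it over to the Gibbs measure, against
   which the integral is taken. *)
- have := null_dominates_ae_eq measurableT (gibbs_dominated (pi := pi) bh)
    (ae_eq_Radon_Nikodym_gibbs pi bh).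
  apply: filterS => x/= /(_ I) -> _.
  rewrite lne_EFin ?mulr_gt0 ?invr_gt0 ?expR_gt0//.
  by rewrite lnM ?posrE ?invr_gt0 ?expR_gt0// lnV ?posrE// expRK.
Qed.

(* Integrating [1 - 1/y <= ln y] at [y = p W expR h], with [p] the density. *)
Lemma KL_ge_gibbs (rho : probability T R) :
  ((- ln W - \int[rho]_x h x)%:E <= KL rho pi)%E.
Proof.
rewrite /KL; case: asboolP => [rhopi|_]; last exact: leey.
have W0 := partition_function_gt0 pi bh.
(* A version of the density that is nonnegative and finite everywhere, so that it can be replaced by
   the real function [r]. *)
pose f := Radon_Nikodym_SigmaFinite.f rho pi.
have f0 : forall x, (0 <= f x)%E := Radon_Nikodym_SigmaFinite.f_ge0 rhopi.
have ff x : f x \is a fin_num := Radon_Nikodym_SigmaFinite.f_fin_num rhopi x.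
have mf : measurable_fun setT f.
  exact/(measurable_int pi)/Radon_Nikodym_SigmaFinite.f_integrable.
rewrite (_ : (\int[_]_x _ = \int[rho]_x lne (f x))%E); last first.
  apply: ae_eq_integral => //.
  - apply: measurableT_comp; first exact: measurable_lne.
    exact/(measurable_int pi)/Radon_Nikodym_integrable.
  - apply: measurableT_comp => //; exact: measurable_lne.
  have := null_dominates_ae_eq measurableT rhopi
    (ae_eq_Radon_Nikodym_SigmaFinite rhopi measurableT).
  by apply: filterS => x/= /(_ I) + _ => <-.
pose r x := fine (f x).
have fE x : f x = (r x)%:E by rewrite fineK.
have r0 x : 0 <= r x by rewrite fine_ge0.
have mr : measurable_fun setT r.
  apply/measurable_EFinP; rewrite (_ : _ \o _ = f)//.
  by apply/funext => x /=; rewrite fE.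
pose q x := expR (- h x) * (r x)^-1.
have mq : measurable_fun setT q.
  apply: measurable_funM; first by case: bexp.
  under eq_fun do rewrite -powR_inv1//.
  exact: (measurableT_comp (measurable_powR (-1))).
have q0 x : 0 <= q x by rewrite mulr_ge0 ?expR_ge0 ?invr_ge0.
(* The density cancels in [q], except where it vanishes: there [0^-1 = 0] makes the integrand [0].
   Hence an inequality, not an equality. *)
have intq : (\int[rho]_x (q x)%:E <= W%:E)%E.
  rewrite -(Radon_Nikodym_SigmaFinite.change_of_variables rhopi)//; last first.
    exact/measurable_EFinP.
  rewrite -EFin_Rintegral//; apply: ge0_le_integral => //.
  - by move=> x _; rewrite mule_ge0 ?lee_fin.
  - by apply: emeasurable_funM => //; exact/measurable_EFinP.
  - by apply/measurable_EFinP; case: bexp.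
  - move=> x _; rewrite -/f fE -EFinM lee_fin /q -mulrA.
    have [->|rx] := eqVneq (r x) 0; first by rewrite !mulr0 expR_ge0.
    by rewrite mulVf// mulr1.
have iq : rho.-integrable setT (EFin \o q).
  apply/integrableP; split; first exact/measurable_EFinP.
  under eq_integral do rewrite gee0_abs ?lee_fin//.
  by rewrite (le_lt_trans intq)// ltry.
(* Subtracting [ln W + h] from [1 - 1/y <= ln y] leaves [g <= ln r], since [1/y = q / W]. *)
pose g x := 1 - ln W - h x - W^-1 * q x.
have b1 : bounded_measurable (fun x => 1 - ln W - h x).
  by apply: bounded_measurableB => //; exact: bounded_measurable_cst.
have iWq : rho.-integrable setT (EFin \o (fun x => W^-1 * q x)).
  by rewrite (_ : _ \o _ = (fun x => (W^-1)%:E * (q x)%:E)%E)//; exact: integrableZl.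
apply: (@le_trans _ _ (\int[rho]_x (g x)%:E)%E).
  rewrite integralB_EFin//; last exact: bounded_measurable_integrable.
  rewrite EFin_Rintegral// bRintegralB//; last exact: bounded_measurable_cst.
  rewrite bRintegral_cst.
  under eq_integral do rewrite EFinM.
  rewrite integralZl//.
  have [fq q1] : (\int[rho]_x (q x)%:E)%E = (\int[rho]_x q x)%:E /\ \int[rho]_x q x <= W.
    have e : (\int[rho]_x (q x)%:E)%E = (\int[rho]_x q x)%:E.
      by rewrite fineK//; exact: integrable_fin_num.
    by split=> //; rewrite -lee_fin -e.
  rewrite fq -EFinM -EFinB lee_fin.
  have : W^-1 * \int[rho]_x q x <= 1 by rewrite ler_pdivrMl// mulr1.
  lra.
have m0 : measurable [set x | r x = 0].
  by rewrite -[X in measurable X]setTI; exact: (mr measurableT _ (measurable_set1 0)).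
have rN0 : {ae rho, forall x, r x != 0}.
  exists [set x | r x = 0]; split.
  - exact: m0.
  - rewrite (Radon_Nikodym_SigmaFinite.f_integral rhopi).
      by apply: integral0_eq => x /= rx0; rewrite -/f fE rx0.
    exact: m0.
  - by move=> x /= /negP; rewrite negbK => /eqP.
apply: le_integral_ae.
- apply/measurable_EFinP; apply: measurable_funB; first by case: b1.
  by apply: measurable_funM => //; exact: measurable_cst.
- by apply: measurableT_comp => //; exact: measurable_lne.
- apply: filterS rN0 => x rx; rewrite fE.
  have rx0 : 0 < r x by rewrite lt_neqAle eq_sym rx r0.
  rewrite lne_EFin// lee_fin /g /q.
  have y0 : 0 < r x * W * expR (h x) by rewrite !mulr_gt0 ?expR_gt0.
  have : 1 + - ln (r x * W * expR (h x)) <= (r x * W * expR (h x))^-1.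
    by rewrite -[in leRHS](lnK y0) -expRN; exact: expR_ge1Dx.
  rewrite !lnM ?posrE ?mulr_gt0 ?expR_gt0// expRK !invfM -expRN.
  rewrite (_ : W^-1 * (expR (- h x) / r x) = (r x)^-1 / W * expR (- h x)); first lra.
  by ring.
Qed.

End KL_variational.

(** * Independent draws and samples *)

Section draws_rectangle.
Context d (T : measurableType d) (R : realType).
Local Open Scope ereal_scope.

Definition rectangle n (A : 'I_n -> set T) : set (n.-tuple T) :=
  [set t | forall i, A i (tnth t i)].

Lemma measurable_rectangle n (A : 'I_n -> set T) :
  (forall i, measurable (A i)) -> measurable (rectangle A).
Proof.
move=> mA.
rewrite (_ : rectangle A =
    \bigcap_(i in [set: 'I_n]) [set t | A i (tnth t i)]).
  apply: fin_bigcap_measurable => // i _.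
  rewrite -[X in measurable X]setTI.
  exact: (measurable_tnth i measurableT (mA i)).
by apply/seteqP; split => [t At i _|t At i]; exact: At.
Qed.

Lemma draws_rectangle n (q : nat -> probability T R) (A : 'I_n -> set T) :
  (forall i, measurable (A i)) ->
  draws n q (rectangle A) = \prod_(i < n) q i (A i).
Proof.
elim: n q A => [|n IH] q A mA.
  rewrite big_ord0 /= diracE mem_set//.
  by case.
rewrite big_ord_recl /=.
rewrite /distribution /pushforward.
rewrite (_ : _ @^-1` _ = A ord0 `*` rectangle (fun i => A (lift ord0 i))).
  rewrite product_measure1E//; last exact: measurable_rectangle.
  congr (_ * _).
  exact: (IH (fun i => q i.+1)).
apply/seteqP; split => [[x t] /= At|[x t] [/= A0 At] i].
  split; first exact: (At ord0).
  by move=> i; have := At (lift ord0 i); rewrite tnthS.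
have [->|[j ->]] : i = ord0 \/ exists j, i = lift ord0 j.
  by case: (unliftP ord0 i) => [j ->|->]; [right; exists j|left].
  by [].
by rewrite tnthS; exact: At.
Qed.

Lemma rectangle_generates n :
  @measurable _ (n.-tuple T) =
  <<s [set B | exists2 A : 'I_n -> set T,
         forall i, measurable (A i) & B = rectangle A] >>.
Proof.
apply/seteqP; split; last first.
  apply: smallest_sub; first exact: sigma_algebra_measurable.
  by move=> _ [A mA ->]; exact: measurable_rectangle.
apply: sub_sigma_algebra2 => B; rewrite -bigcup_seq => -[i _ [A mA <-]].
exists (fun j => if j == i then A else setT).
  by move=> j; case: ifP.
rewrite setTI; apply/seteqP; split => t /=.
  by move=> At j; case: eqVneq => [->|].
by move=> /(_ i); rewrite eqxx.
Qed.

(** Rectangles are stable under intersection and generate the sigma-algebra, so they determine a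
    finite measure. This turns product formulas into an identity of joint laws. *)
Lemma draws_unique n (q : nat -> probability T R)
    (mu : probability (n.-tuple T) R) :
  (forall A : 'I_n -> set T, (forall i, measurable (A i)) ->
    mu (rectangle A) = \prod_(i < n) q i (A i)) ->
  forall B, measurable B -> mu B = draws n q B.
Proof.
move=> muA B mB.
apply: (measure_unique _ (fun _ => setT) (rectangle_generates n)) => //.
- move=> _ _ [A mA ->] [A' mA' ->]; exists (fun i => A i `&` A' i).
    by move=> i; exact: measurableI.
  apply/seteqP; split => t /=; first by move=> [At A't] i; split; [exact: At|exact: A't].
  by move=> AA't; split=> i; have [] := AA't i.
- move=> _; exists (fun=> setT) => //.
  by apply/seteqP; split.
- exact: bigcup_const.
- move=> _ [A mA ->]; exact: (etrans (muA A mA) (esym (draws_rectangle q mA))).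
- by move=> _; rewrite -ge0_fin_numE// fin_num_measure.
Qed.

Lemma draws_marginal n (q : nat -> probability T R) (i : 'I_n) (A : set T) :
  measurable A -> draws n q [set t | A (tnth t i)] = q i A.
Proof.
move=> mA.
pose A_ j := if j == i then A else setT.
rewrite (_ : [set t | _] = rectangle A_).
  rewrite draws_rectangle; last by move=> j; rewrite /A_; case: ifP.
  rewrite (bigD1 i)//= big1 ?mule1; first by rewrite /A_ eqxx.
  by move=> j /negbTE ji; rewrite /A_ ji probability_setT.
apply/seteqP; split => t /=.
  by move=> At j; rewrite /A_; case: eqVneq => [->|].
by move=> /(_ i); rewrite /A_ eqxx.
Qed.

(** A uniformly chosen entry sees the joint law only through its marginals: the output law is the
    equal-weight mixture of the [q i]. *)
Lemma output_law_draws n (q : nat -> probability T R) (A : set T) :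
  measurable A ->
  output_law (draws n.+1 q) A = (n.+1%:R^-1)%:E * \sum_(i < n.+1) q i A.
Proof.
move=> mA; rewrite /output_law.
transitivity (\int[draws n.+1 q]_t ((n.+1%:R^-1)%:E *
   \sum_(i < n.+1) (\1_[set t | A (tnth t i)] t)%:E)).
  apply: eq_integral => t _.
  rewrite /uniform_choice /mscale/= /msum; congr (_ * _).
  by apply: eq_bigr => i _; rewrite -tnth_nth.
have mi i : measurable [set t : n.+1.-tuple T | A (tnth t i)].
  rewrite -[X in measurable X]setTI.
  exact: (measurable_tnth i measurableT mA).
have mfi i : measurable_fun setT (fun t : n.+1.-tuple T =>
    (\1_[set t | A (tnth t i)] t)%:E : \bar R).
  by apply/measurable_EFinP; exact: measurable_indic.
have m_sum : measurable_fun setT (fun t : n.+1.-tuple T =>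
    \sum_(i < n.+1) (\1_[set t | A (tnth t i)] t)%:E : \bar R).
  exact: emeasurable_sum.
rewrite ge0_integralZl//; last by move=> t _; apply: sume_ge0.
rewrite ge0_integral_sum//; congr (_ * _); apply: eq_bigr => i _.
by rewrite integral_indic// setIT; exact: (draws_marginal q i mA).
Qed.

Lemma Rintegral_output_law n (q : nat -> probability T R) (f : T -> R) :
  bounded_measurable f ->
  (\int[output_law (draws n.+1 q)]_x f x =
   n.+1%:R^-1 * \sum_(i < n.+1) \int[q i]_x f x)%R.
Proof.
move=> bf; have [mf [M fM]] := bf.
(* Integration against scaled and summed measures is applied to nonnegative functions; the shift by
   [M] makes [f] nonnegative and changes both sides equally. *)
have bfM : bounded_measurable (fun x => f x + M)%R.
  by apply: bounded_measurableD => //; exact: bounded_measurable_cst.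
have fM0 x : (0 <= f x + M)%R.
  by have := fM x; rewrite ler_norml => /andP[]; rewrite -subr_ge0 opprK addrC.
suff : (\int[output_law (draws n.+1 q)]_x (f x + M) =
   n.+1%:R^-1 * \sum_(i < n.+1) \int[q i]_x (f x + M))%R.
  have shift (mu : probability T R) : (\int[mu]_x (f x + M) = \int[mu]_x f x + M)%R.
    by rewrite bRintegralD ?bRintegral_cst//; exact: bounded_measurable_cst.
  rewrite shift; under [in RHS]eq_bigr do rewrite shift.
  rewrite big_split/= sumr_const card_ord mulrDr -(mulr_natl M) mulKf//.
  exact: addIr.
have mfM : measurable_fun setT (EFin \o (fun x => f x + M)%R).
  by apply/measurable_EFinP; case: bfM.
apply: EFin_inj; rewrite -EFin_Rintegral//.
rewrite (eq_measure_integral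
  (mscale ((n.+1%:R^-1)%:nng)%R (msum (fun i => q i) n.+1))); last first.
  by move=> A mA _; exact: output_law_draws.
rewrite ge0_integral_mscale//; last by move=> x _; rewrite lee_fin.
rewrite ge0_integral_measure_sum//; last by move=> x _; rewrite lee_fin.
rewrite EFinM -sumEFin; congr (_ * _); apply: eq_bigr => i _.
by rewrite EFin_Rintegral.
Qed.

End draws_rectangle.

(** * Gibbs measures depending measurably on a parameter *)

Section gibbs_parametric.
Context d d' (U : measurableType d) (T : measurableType d') (R : realType).
Variables (pi : probability T R) (H : U * T -> R) (h : U -> {mfun T >-> R}).
Hypotheses (bH : bounded_measurable H) (hE : forall u x, h u x = H (u, x)).

Lemma bounded_measurable_section u : bounded_measurable (h u).
Proof.
rewrite (_ : (h u : T -> R) = fun x => H (u, x)); last by apply/funext => x.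
exact: bounded_measurable_pair1.
Qed.

Lemma bounded_measurable_partition_function :
  bounded_measurable (fun u => partition_function pi (h u)).
Proof.
rewrite (_ : (fun _ => _) = fun u => \int[pi]_x expR (- H (u, x))).
  apply: (bounded_measurable_Rintegral1 (f := fun ux => expR (- H ux))).
  exact/bounded_measurable_expR/bounded_measurableN.
by apply/funext => u; apply: eq_Rintegral => x _; rewrite hE.
Qed.

(** A bound [M] of [H] keeps the partition function above [expR (- M)] uniformly in [u], away from
    the singularity of [ln]. *)
Lemma bounded_measurable_ln_partition_function :
  bounded_measurable (fun u => ln (partition_function pi (h u))).
Proof.
have [mH [M HM]] := bH.
apply: (@bounded_measurable_ln _ _ _ _ (expR (- M))); first exact: expR_gt0.
  move=> u; rewrite -[leLHS](bRintegral_cst pi); apply: bRintegral_le.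
  - exact: bounded_measurable_cst.
  - exact/bounded_measurable_expR/bounded_measurableN/bounded_measurable_section.
  - by move=> x; rewrite ler_expR lerN2 hE (le_trans (ler_norm _)).
exact: bounded_measurable_partition_function.
Qed.

(** The Gibbs integral is a quotient of two partial integrals of jointly measurable functions, hence
    measurable in [u]. *)
Lemma bounded_measurable_Rintegral_gibbs (f : T -> R) : bounded_measurable f ->
  bounded_measurable (fun u => \int[gibbs pi (h u)]_x f x).
Proof.
move=> bf; have [mf [M fM]] := bf; split; last first.
  exists M => u; rewrite ler_norml; apply: bRintegral_itv => // x.
  by rewrite -ler_norml.
rewrite (_ : (fun _ => _) = fun u => partition_function pi (h u) `^ (-1) *
    \int[pi]_x (f x * expR (- H (u, x)))); last first.
  apply/funext => u; have bh := bounded_measurable_section u.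
  rewrite (Rintegral_gibbs pi bh bf) (powR_inv1 (ltW (partition_function_gt0 pi bh))).
  by congr (_ * _); apply: eq_Rintegral => x _; rewrite hE.
apply: measurable_funM.
  apply: (measurableT_comp (measurable_powR (-1))).
  by case: bounded_measurable_partition_function.
have bfH : bounded_measurable (fun ux => f ux.2 * expR (- H ux)).
  apply: bounded_measurableM; first exact: (bounded_measurable_comp (phi := snd)).
  exact/bounded_measurable_expR/bounded_measurableN.
exact: (bounded_measurable_Rintegral1 bfH pi).1.
Qed.

End gibbs_parametric.

(** * The law of an i.i.d. sample *)

Section iid_sample.
Context d d' (Omega : measurableType d) (T : measurableType d') (R : realType).
Variables (Pr : probability Omega R) (P : probability T R) (n : nat).
Variable X : 'I_n -> {mfun Omega >-> T}.

Definition sample (w : Omega) : n.-tuple T := [tuple X i w | i < n].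

Let measurable_sample : measurable_fun setT sample.
Proof.
apply/measurable_fun_tnthP => i.
rewrite (_ : _ \o _ = X i)//.
by apply/funext => w /=; rewrite tnth_mktuple.
Qed.

HB.instance Definition _ :=
  isMeasurableFun.Build _ _ _ _ sample measurable_sample.

Hypothesis law : forall i, has_law Pr (X i) P.
Hypothesis indep : mutually_independent Pr X.

(** Independence over the full index set, with the common law [P], is the product formula on
    rectangles; integrating functions of the whole sample requires it on all measurable sets. *)
Lemma sample_law (B : set (n.-tuple T)) : measurable B ->
  distribution Pr sample B = draws n (fun=> P) B.
Proof.
apply: draws_unique => A mA.
have := indep [set: 'I_n]%SET mA.
under eq_bigr => i _.
  rewrite (_ : Pr _ = P (A i)); last exact: (law i (mA i)).
  over.
move=> indepA; rewrite (eq_bigl (mem [set: 'I_n]%SET)); last by move=> i; rewrite !inE.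
rewrite -indepA; congr (Pr _); apply/seteqP; split => w /= Aw i.
  by move=> _; have := Aw i; rewrite tnth_mktuple.
by rewrite tnth_mktuple; apply: Aw; rewrite /= inE.
Qed.

Lemma Rintegral_sample (F : n.-tuple T -> R) : bounded_measurable F ->
  \int[Pr]_w F (sample w) = \int[draws n (fun=> P)]_t F t.
Proof.
move=> bF; rewrite -(bRintegral_distribution Pr sample bF) /Rintegral.
congr fine; apply: eq_measure_integral => B mB _; exact: sample_law.
Qed.

End iid_sample.

(** * Regret *)

Section seqrand_regret.
Context dZ dG (Z : measurableType dZ) (G : measurableType dG) (R : realType).
Variable L : {mfun (Z * G)%type >-> R}.
Variables (a b lambda : R) (pi : probability G R) (P : probability Z R).
Hypotheses (Lab : forall z g, a <= L (z, g) <= b) (lambda0 : 0 < lambda).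

Let delta := lambda * (b - a) ^+ 2 / 8.

Let bL : bounded_measurable L.
Proof. by apply: bounded_measurable_itv => // -[z g]. Qed.

Definition mean_risk (g : G) : R := \int[P]_z L (z, g).

Lemma bounded_measurable_mean_risk : bounded_measurable mean_risk.
Proof.
apply: (bounded_measurable_Rintegral1 (f := L \o (fun gz => (gz.2, gz.1)))).
apply: bounded_measurable_comp => //.
exact: measurable_swap.
Qed.

(** One step of the recursion behind [cumulative]: folding it over [take i zs] from [cst 0] gives
    [S_i] by conversion. *)
Definition add_loss (c : R) (S : {mfun G >-> R}) (z : Z) : {mfun G >-> R} :=
  (S + loss_at L z + cst c)%R.

Lemma foldl_add_lossE c S (zs : seq Z) g :
  foldl (add_loss c) S zs g = S g + \sum_(z <- zs) (L (z, g) + c).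
Proof.
elim: zs S => [|z zs IH] S; first by rewrite big_nil addr0.
by rewrite /= IH big_cons /add_loss /= !addrA.
Qed.

Lemma bounded_measurable_foldl_add_loss c (S : {mfun G >-> R}) n i :
  bounded_measurable S -> (i <= n)%N ->
  bounded_measurable (fun tg : n.-tuple Z * G =>
    foldl (add_loss c) S (take i tg.1) tg.2).
Proof.
move=> bS ni.
rewrite (_ : (fun _ => _) = fun tg : n.-tuple Z * G => S tg.2 +
    \sum_(j < i) (L (tnth tg.1 (widen_ord ni j), tg.2) + c)).
  apply: bounded_measurableD.
    exact: (bounded_measurable_comp (phi := snd)).
  apply: bounded_measurable_sum => j; apply: bounded_measurableD; last first.
    exact: bounded_measurable_cst.
  apply: (bounded_measurable_comp (phi := fun tg : n.-tuple Z * G =>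
    (tnth tg.1 (widen_ord ni j), tg.2))) => //.
  apply: measurable_fun_pair => //=.
  by apply: (measurableT_comp (measurable_tnth _)).
apply/funext => -[t g] /=; rewrite foldl_add_lossE; congr (_ + _).
rewrite (big_nth point) size_takel ?size_tuple// big_mkord.
by apply: eq_bigr => j _; rewrite nth_take// (tnth_nth point).
Qed.

Definition tempered (S : {mfun G >-> R}) : {mfun G >-> R} :=
  (cst lambda * S)%R.

(** The potential [Phi]. *)
Definition free_energy (S : {mfun G >-> R}) : R :=
  - ln (partition_function pi (tempered S)) / lambda.

Lemma bounded_measurable_tempered (S : {mfun G >-> R}) : bounded_measurable S ->
  bounded_measurable (tempered S).
Proof. exact: bounded_measurableZ. Qed.

Lemma bounded_measurable_add_loss c (S : {mfun G >-> R}) z : bounded_measurable S ->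
  bounded_measurable (add_loss c S z).
Proof.
move=> bS; apply: bounded_measurableD; last exact: bounded_measurable_cst.
by apply: bounded_measurableD => //; exact: bounded_measurable_pair1.
Qed.

Lemma Rintegral_loss_le (S : {mfun G >-> R}) z : bounded_measurable S ->
  \int[gibbs pi (tempered S)]_g L (z, g) <=
  free_energy (add_loss delta S z) - free_energy S.
Proof.
move=> bS; set h := tempered S.
have bh : bounded_measurable h by exact: bounded_measurable_tempered.
have W0 := partition_function_gt0 pi bh.
have bSz := bounded_measurable_add_loss delta z bS.
have W'0 := partition_function_gt0 pi (bounded_measurable_tempered bSz).
have bLz : bounded_measurable (fun g => L (z, g)) := bounded_measurable_pair1 bL z.
have be : bounded_measurable (fun g => expR (- (lambda * L (z, g)))).
  exact/bounded_measurable_expR/bounded_measurableN/bounded_measurableZ.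
have W'E : partition_function pi (tempered (add_loss delta S z)) =
    expR (- (lambda * delta)) * (partition_function pi h *
      \int[gibbs pi h]_g expR (- (lambda * L (z, g)))).
  rewrite Rintegral_gibbs// mulVKf ?gt_eqF// -bRintegralZ; last first.
    exact/bounded_measurableM/bounded_measurable_expR/bounded_measurableN.
  apply: eq_Rintegral => g _; rewrite -!expRD; congr expR.
  change (- (lambda * (S g + L (z, g) + delta)) =
    - (lambda * delta) + (- (lambda * L (z, g)) + - (lambda * S g))).
  by ring.
have Hoef := hoeffding_mgf (gibbs pi h) bLz.1 (Lab z) (ltW lambda0).
(* The value of [delta] is exactly the one for which [expR (- (lambda * delta))] cancels the
   quadratic term of Hoeffding's lemma. *)
have W'le : partition_function pi (tempered (add_loss delta S z)) <=
    partition_function pi h * expR (- (lambda * \int[gibbs pi h]_g L (z, g))).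
  rewrite W'E mulrCA ler_pM2l//.
  apply: (le_trans (ler_wpM2l (expR_ge0 _) Hoef)).
  by rewrite -expRD ler_expR /delta le_eqVlt; apply/orP; left; apply/eqP; ring.
rewrite /free_energy -mulrBl ler_pdivlMr//.
move: W'le W0 W'0; set W := partition_function pi h.
move: (partition_function _ _) (Rintegral _ _ _) => W' I W'le W0 W'0.
move: W'le; rewrite -ler_ln ?posrE ?mulr_gt0 ?expR_gt0// lnM ?posrE ?expR_gt0// expRK.
by move: (ln _) (ln _) => u v; lra.
Qed.

Lemma bounded_measurable_free_energy (S : {mfun G >-> R}) :
  bounded_measurable S ->
  bounded_measurable (fun z => free_energy (add_loss delta S z)).
Proof.
move=> bS; apply: bounded_measurableM; last exact: bounded_measurable_cst.
apply: bounded_measurableN.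
apply: (bounded_measurable_ln_partition_function pi
  (H := fun zg => lambda * (S zg.2 + L zg + delta))); last by [].
apply/bounded_measurableZ/bounded_measurableD; last exact: bounded_measurable_cst.
by apply: bounded_measurableD => //; exact: (bounded_measurable_comp (phi := snd)).
Qed.

Lemma Rintegral_mean_risk_le (S : {mfun G >-> R}) : bounded_measurable S ->
  \int[gibbs pi (tempered S)]_g mean_risk g + free_energy S <=
  \int[P]_z free_energy (add_loss delta S z).
Proof.
move=> bS; have bFz := bounded_measurable_free_energy bS.
have bc := bounded_measurable_cst Z (free_energy S).
rewrite -lerBrDr; have -> :
    \int[P]_z free_energy (add_loss delta S z) - free_energy S =
    \int[P]_z (free_energy (add_loss delta S z) - free_energy S).
  exact: esym (etrans (bRintegralB P bFz bc)
    (congr1 (+%R _ \o -%R) (bRintegral_cst P _))).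
rewrite /mean_risk -(bRintegral_fubini bL).
apply: (bRintegral_le P _ (bounded_measurableB bFz bc)).
  exact: bounded_measurable_Rintegral1.
by move=> z; exact: Rintegral_loss_le.
Qed.

Lemma Rintegral_add_loss (rho : probability G R) c (S : {mfun G >-> R}) z :
  bounded_measurable S ->
  \int[rho]_g add_loss c S z g =
  \int[rho]_g S g + c + \int[rho]_g L (z, g).
Proof.
move=> bS; have bLz := bounded_measurable_pair1 bL z.
rewrite (_ : Rintegral _ _ _ = \int[rho]_g (S g + c + L (z, g))); last first.
  apply: eq_Rintegral => g _.
  change (S g + L (z, g) + c = S g + c + L (z, g)).
  by rewrite addrAC.
have bd := bounded_measurable_cst G c.
by rewrite !bRintegralD ?bRintegral_cst//; exact: bounded_measurableD.
Qed.

Lemma bounded_measurable_Rintegral_loss (rho : probability G R) :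
  bounded_measurable (fun z => \int[rho]_g L (z, g)).
Proof. exact: bounded_measurable_Rintegral1. Qed.

(** The start [S] is arbitrary, so that what follows a first observation [z] is again of this form,
    started from [add_loss delta S z]. *)
Definition posterior_risk (S : {mfun G >-> R}) (zs : seq Z) (i : nat) : R :=
  \int[gibbs pi (tempered (foldl (add_loss delta) S (take i zs)))]_g mean_risk g.

Lemma bounded_measurable_posterior_risk n (S : {mfun G >-> R}) i :
  bounded_measurable S -> (i <= n)%N ->
  bounded_measurable (fun t : n.-tuple Z => posterior_risk S t i).
Proof.
move=> bS ni; apply: (bounded_measurable_Rintegral_gibbs pi
  (H := fun tg : n.-tuple Z * G =>
     lambda * foldl (add_loss delta) S (take i tg.1) tg.2)) => //.
  exact/bounded_measurableZ/bounded_measurable_foldl_add_loss.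
exact: bounded_measurable_mean_risk.
Qed.

Lemma bounded_measurable_sum_posterior_risk n (S : {mfun G >-> R}) :
  bounded_measurable S ->
  bounded_measurable (fun t : n.-tuple Z => \sum_(i < n.+1) posterior_risk S t i).
Proof.
move=> bS; apply: bounded_measurable_sum => i.
by apply: bounded_measurable_posterior_risk; rewrite // -ltnS.
Qed.

Variables (rho : probability G R) (c : R).
Hypothesis free_energy_le : forall S : {mfun G >-> R}, bounded_measurable S ->
  free_energy S <= \int[rho]_g S g + c.

(** Averaging over a fresh observation turns its loss into the mean risk. Each observation thus
    costs one mean risk under [rho] plus [delta], in the base case as in the induction step. *)
Let Rintegral_potential (S : {mfun G >-> R}) (F : Z -> R) k :
  bounded_measurable S -> bounded_measurable F ->
  (forall z, F z <= k + \int[rho]_g add_loss delta S z g) ->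
  \int[P]_z F z <=
  k + (\int[rho]_g S g + \int[rho]_g mean_risk g + delta).
Proof.
move=> bS bF Fk; have bI := bounded_measurable_Rintegral_loss rho.
pose A := k + (\int[rho]_g S g + delta).
have -> : k + (\int[rho]_g S g + \int[rho]_g mean_risk g + delta) =
    \int[P]_z (A + \int[rho]_g L (z, g)).
  rewrite bRintegralD//; last exact: bounded_measurable_cst.
  rewrite bRintegral_cst (bRintegral_fubini bL) -/mean_risk /A.
  by rewrite [in LHS]addrAC addrA.
apply: bRintegral_le => //.
  by apply: bounded_measurableD => //; exact: bounded_measurable_cst.
by move=> z; rewrite (le_trans (Fk z))// Rintegral_add_loss// addrA.
Qed.

(** Of the variational formula only an affine upper bound of the free energy is retained, with [c]
    standing for [K(rho, pi) / lambda]. As [S] varies, the bound applies to the potential reached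
    after all observations. *)
Lemma seqrand_regret n (S : {mfun G >-> R}) : bounded_measurable S ->
  \int[draws n (fun=> P)]_t (\sum_(i < n.+1) posterior_risk S t i)
  + free_energy S
  <= n.+1%:R * (\int[rho]_g mean_risk g + delta) + \int[rho]_g S g + c.
Proof.
elim: n S => [|n IH] S bS.
  have bF := bounded_measurable_sum_posterior_risk 0 bS.
  (* With an empty sample there is still one posterior; its increment uses the fictitious
     observation, integrated under [P]. *)
  rewrite (_ : Rintegral _ _ _ = posterior_risk S [::] 0); last first.
    rewrite /Rintegral [X in fine X]integral_dirac//; last first.
      by apply/measurable_EFinP; case: bF.
    by rewrite diracT mul1e/= big_ord1.
  apply: (le_trans (Rintegral_mean_risk_le bS)).
  apply: le_trans (Rintegral_potential (k := c) bS
    (bounded_measurable_free_energy bS) _) _.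
    by move=> z; rewrite addrC; exact/free_energy_le/bounded_measurable_add_loss.
  by rewrite mul1r le_eqVlt; apply/orP; left; apply/eqP; ring.
pose V (S' : {mfun G >-> R}) :=
  \int[draws n (fun=> P)]_t (\sum_(i < n.+1) posterior_risk S' t i).
pose f := (fun t : n.+1.-tuple Z => \sum_(i < n.+2) posterior_risk S t i)
  \o @cons_pair _ Z n.
have bf : bounded_measurable f.
  apply: bounded_measurable_comp => //.
  exact: bounded_measurable_sum_posterior_risk.
(* The term [i = 0] ignores the data because [take 0] is empty; the others see [z] only through the
   new start [add_loss delta S z]. *)
have inner z : \int[draws n (fun=> P)]_t f (z, t) =
    posterior_risk S [::] 0 + V (add_loss delta S z).
  rewrite -[X in X + _](bRintegral_cst (draws n (fun=> P))) -bRintegralD.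
  - by apply: eq_Rintegral => t _; rewrite /f/= big_ord_recl.
  - exact: bounded_measurable_cst.
  - exact/bounded_measurable_sum_posterior_risk/bounded_measurable_add_loss.
have bV : bounded_measurable (fun z => V (add_loss delta S z)).
  rewrite (_ : (fun _ => _) = fun z =>
    \int[draws n (fun=> P)]_t f (z, t) - posterior_risk S [::] 0); last first.
    by apply/funext => z; rewrite inner addrAC subrr add0r.
  apply: bounded_measurableB; last exact: bounded_measurable_cst.
  exact: bounded_measurable_Rintegral1.
have VS : \int[draws n.+1 (fun=> P)]_t (\sum_(i < n.+2) posterior_risk S t i) =
    posterior_risk S [::] 0 + \int[P]_z V (add_loss delta S z).
  rewrite [LHS](bRintegral_distribution _ (@cons_pair _ Z n)); last first.
    exact: bounded_measurable_sum_posterior_risk.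
  rewrite [LHS](bRintegral_fubini1 bf).
  under eq_Rintegral do rewrite inner.
  by rewrite bRintegralD ?bRintegral_cst//; exact: bounded_measurable_cst.
have bF := bounded_measurable_free_energy bS.
rewrite VS addrAC.
(* The telescoping step: the averaged free energy at [add_loss delta S z] produced here is the one
   that the induction hypothesis absorbs for each [z]. *)
apply: (le_trans (lerD (Rintegral_mean_risk_le bS) (lexx _))).
rewrite -bRintegralD//.
pose k := n.+1%:R * (\int[rho]_g mean_risk g + delta) + c.
apply: le_trans (Rintegral_potential (k := k) bS _ _) _.
- exact: bounded_measurableD.
- move=> z; rewrite addrC /k addrAC; apply: IH.
  exact: bounded_measurable_add_loss.
- rewrite /k -[in leRHS]natr1 le_eqVlt; apply/orP; left; apply/eqP; ring.
Qed.

End seqrand_regret.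

(** * From the regret to the risk of the output law *)

Section average_risk.
Context dZ dG dW (Z : measurableType dZ) (G : measurableType dG)
  (Omega : measurableType dW) (R : realType).
Variable L : {mfun (Z * G)%type >-> R}.
Variables (a b : R) (P : probability Z R).
Hypothesis Lab : forall z g, a <= L (z, g) <= b.
Variables (Pr : probability Omega R) (n : nat) (X : 'I_n -> {mfun Omega >-> Z}).
Hypotheses (law : forall i, has_law Pr (X i) P)
  (indep : mutually_independent Pr X).

Let delta lambda : R := lambda * (b - a) ^+ 2 / 8.

Let bL : bounded_measurable L.
Proof. by apply: bounded_measurable_itv => // -[z g]. Qed.

Lemma riskE g : risk L P g = (mean_risk L P g)%:E.
Proof.
rewrite /risk unlock EFin_Rintegral//; exact: bounded_measurable_pair2.
Qed.

Lemma average_riskE lambda pi :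
  (\int[Pr]_w
     \int[seqrand L lambda (delta lambda) pi [tuple X i w | i < n]]_g risk L P g =
   (n.+1%:R^-1 * \int[draws n (fun=> P)]_t
     (\sum_(i < n.+1) posterior_risk L a b lambda pi P (cst 0%R) t i))%:E)%E.
Proof.
have br := bounded_measurable_mean_risk P Lab.
pose F (t : n.-tuple Z) := n.+1%:R^-1 *
     (\sum_(i < n.+1) posterior_risk L a b lambda pi P (cst 0%R) t i).
have bs : bounded_measurable (fun t : n.-tuple Z =>
    \sum_(i < n.+1) posterior_risk L a b lambda pi P (cst 0%R) t i).
  by apply: bounded_measurable_sum_posterior_risk => //; exact: bounded_measurable_cst.
have bF : bounded_measurable F by exact: bounded_measurableZ.
rewrite -bRintegralZ// -(Rintegral_sample law indep bF) -EFin_Rintegral; last first.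
  exact: (bounded_measurable_comp (phi := sample X)).
apply: eq_integral => w _; under eq_integral do rewrite riskE.
rewrite EFin_Rintegral//; congr EFin.
(* By conversion, [posterior] is the Gibbs law of the tempered fold in [posterior_risk]. *)
exact: (Rintegral_output_law n (posterior L lambda (delta lambda) pi (sample X w)) br).
Qed.

Lemma partition_function_cst0 (pi : probability G R) lambda :
  partition_function pi (tempered lambda (cst 0)) = 1.
Proof.
rewrite -[RHS](bRintegral_cst pi); apply: eq_Rintegral => g _.
by change (expR (- (lambda * 0)) = 1); rewrite mulr0 oppr0 expR0.
Qed.

Section positive_temperature.
Variables (lambda : R) (pi : probability G R).
Hypothesis lambda0 : 0 < lambda.

Definition mean_risk_mfun : {mfun G >-> R} :=
  HB.pack (mean_risk L P) (isMeasurableFun.Build _ _ _ _ _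
    (bounded_measurable_mean_risk P Lab).1).

Definition scaled_risk : {mfun G >-> R} :=
  (cst (lambda * n.+1%:R) * mean_risk_mfun)%R.

Lemma scaled_riskE g : scaled_risk g = lambda * n.+1%:R * mean_risk L P g.
Proof. by []. Qed.

Let lambdan0 : 0 < lambda * n.+1%:R.
Proof. by rewrite mulr_gt0// ltr0n. Qed.

Lemma bounded_measurable_scaled_risk : bounded_measurable scaled_risk.
Proof. exact/bounded_measurableZ/bounded_measurable_mean_risk. Qed.

Let bh := bounded_measurable_scaled_risk.

Lemma Rintegral_scaled_risk (rho : probability G R) :
  \int[rho]_g scaled_risk g = lambda * n.+1%:R * \int[rho]_g mean_risk L P g.
Proof.
rewrite -bRintegralZ//; exact: bounded_measurable_mean_risk.
Qed.

Definition optimal_bound : R :=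
  delta lambda - ln (partition_function pi scaled_risk) / (lambda * n.+1%:R).

Definition bound (rho : probability G R) : \bar R :=
  (\int[rho]_g risk L P g + (delta lambda)%:E
      + KL rho pi * ((lambda * n.+1%:R)^-1)%:E)%E.

(** For [h = scaled_risk] the lower bound on the divergence, divided by [lambda * n.+1%:R], contains
    minus the mean risk under [rho]. It cancels the risk in [bound] and leaves a constant free of
    [rho]. *)
Lemma optimal_bound_le (rho : probability G R) : (optimal_bound%:E <= bound rho)%E.
Proof.
rewrite /bound; under eq_integral do rewrite riskE.
rewrite EFin_Rintegral; last exact: bounded_measurable_mean_risk.
have := lee_wpmul2r (x := ((lambda * n.+1%:R)^-1)%:E) _ (KL_ge_gibbs pi bh rho).
rewrite lee_fin invr_ge0 (ltW lambdan0) => /(_ isT) KLge.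
apply: le_trans (leeD (lexx _) KLge).
rewrite -EFinM -!EFinD lee_fin Rintegral_scaled_risk /optimal_bound.
rewrite le_eqVlt; apply/orP; left; apply/eqP.
move: (ln _) (Rintegral _ _ _) => u v; field.
by rewrite addrC natr1 pnatr_eq0/= gt_eqF.
Qed.

Lemma bound_gibbs : bound (gibbs pi scaled_risk) = optimal_bound%:E.
Proof.
rewrite /bound; under eq_integral do rewrite riskE.
rewrite EFin_Rintegral; last exact: bounded_measurable_mean_risk.
rewrite KL_gibbs// -EFinM -!EFinD Rintegral_scaled_risk /optimal_bound; congr EFin.
move: (ln _) (Rintegral _ _ _) => u v; field.
by rewrite addrC natr1 pnatr_eq0/= gt_eqF.
Qed.

Lemma average_risk_le :
  (\int[Pr]_w
     \int[seqrand L lambda (delta lambda) pi [tuple X i w | i < n]]_g risk L P g <=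
   optimal_bound%:E)%E.
Proof.
rewrite average_riskE lee_fin.
set rho := gibbs pi scaled_risk.
set W := partition_function pi scaled_risk.
(* This is [K(rho, pi) / lambda] by [KL_gibbs], a finite real. The affine bound on the free energy
   is [KL_ge_gibbs] for [lambda * S], rearranged. *)
pose c := (- ln W - \int[rho]_g scaled_risk g) / lambda.
have free_le (S : {mfun G >-> R}) : bounded_measurable S ->
    free_energy lambda pi S <= \int[rho]_g S g + c.
  move=> bS.
  have bt : bounded_measurable (tempered lambda S) by exact: bounded_measurableZ.
  have := KL_ge_gibbs pi bt rho.
  rewrite KL_gibbs// lee_fin -/rho.
  have -> : \int[rho]_g tempered lambda S g = lambda * \int[rho]_g S g.
    by rewrite -bRintegralZ.
  rewrite /free_energy /c ler_pdivrMr// mulrDl divfK ?gt_eqF//.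
  move: (ln _) (Rintegral _ _ _) (Rintegral _ _ _) => u v w; lra.
have := seqrand_regret P Lab lambda0 free_le n (S := cst 0) (bounded_measurable_cst G 0).
rewrite {1}/free_energy partition_function_cst0 ln1 oppr0 mul0r addr0.
rewrite [X in _ <= _ + X + _](_ : _ = 0); last exact: bRintegral_cst.
rewrite addr0 /c Rintegral_scaled_risk -/(delta lambda) => regret.
rewrite ler_pdivrMl ?ltr0n//; apply: (le_trans regret).
rewrite /optimal_bound -/W le_eqVlt; apply/orP; left; apply/eqP.
move: (ln _) (Rintegral _ _ _) => u v; field.
by rewrite addrC natr1 pnatr_eq0/= gt_eqF.
Qed.

End positive_temperature.
End average_risk.

(** * Finite models *)

Section finite_model.
Context d (T : measurableType d) (R : realType).
Hypothesis finT : finite_set [set: T].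

Let card : R := #|` fset_set [set: T]|%:R.

Let card_gt0 : 0 < card.
Proof.
rewrite ltr0n cardfs_gt0; apply/fset0Pn; exists point.
by rewrite in_fset_set// inE.
Qed.

Lemma finite_argmin (f : T -> R) : exists x0, forall x, f x0 <= f x.
Proof.
have inT x : x \in fset_set [set: T] by rewrite in_fset_set// inE.
pose x0 : fset_set [set: T] := [` inT point]%fset.
have [i _ imin] := @arg_minP _ _ _ x0 predT (fun x : fset_set [set: T] => f (val x)) isT.
by exists (val i) => x; have := imin [` inT x]%fset isT.
Qed.

Lemma uniform_on_ge (A : set T) x : measurable A -> A x ->
  ((card^-1)%:E <= uniform_on T R A)%E.
Proof.
move=> mA Ax.
have finA : finite_set A by exact: sub_finite_set finT.
have cT : counting [set: T] = card%:E by rewrite /counting asboolT.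
change ((card^-1)%:E <= mnormalize (@counting T R) \d_(@point T) A)%E.
rewrite /mnormalize [X in (X == _) || _]cT [X in _ || (X == _)]cT.
rewrite eqe gt_eqF//= [X in fine X]cT/=.
rewrite /counting asboolT// -EFinM lee_fin ler_peMl ?invr_ge0 ?(ltW card_gt0)//.
rewrite ler1n cardfs_gt0; apply/fset0Pn; exists x.
by rewrite in_fset_set// inE.
Qed.

(** Only the contribution of the level set of [h] through [x] is kept. Unlike the singleton [x], it
    is always measurable; it contains [x], so its mass is at least [card^-1], and the integrand is
    constant on it. *)
Lemma partition_function_uniform_ge (h : {mfun T >-> R}) x :
  bounded_measurable h ->
  - ln (partition_function (uniform_on T R) h) <= h x + ln card.
Proof.
move=> bh; set U := uniform_on T R.
pose A := h @^-1` [set h x].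
have mA : measurable A.
  rewrite -[X in measurable X]setTI.
  exact: (measurable_funPT h measurableT _ (measurable_set1 _)).
have bA : bounded_measurable (fun y => expR (- h x) * \1_A y).
  apply: bounded_measurableZ; apply: (@bounded_measurable_itv _ _ _ _ 0 1).
    exact: measurable_indic.
  by move=> y; rewrite indicE; case: (y \in A); rewrite ?lexx ler01.
have : expR (- h x) * card^-1 <= partition_function U h.
  apply: (@le_trans _ _ (\int[U]_y (expR (- h x) * \1_A y))).
    rewrite bRintegralZ; last first.
      apply: (@bounded_measurable_itv _ _ _ _ 0 1).
        exact: measurable_indic.
      by move=> y; rewrite indicE; case: (y \in A); rewrite ?lexx ler01.
    rewrite ler_wpM2l ?expR_ge0// /Rintegral integral_indic// setIT.
    rewrite -lee_fin fineK ?fin_num_measure//.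
    exact: uniform_on_ge (erefl : A x).
  apply: bRintegral_le => //.
    exact/bounded_measurable_expR/bounded_measurableN.
  move=> y; rewrite indicE; case: (boolP (y \in A)) => [|_].
    by rewrite inE /A/= => ->; rewrite mulr1.
  by rewrite mulr0 expR_ge0.
have W0 := partition_function_gt0 U bh.
rewrite -ler_ln ?posrE ?mulr_gt0 ?invr_gt0 ?expR_gt0//.
rewrite lnM ?posrE ?invr_gt0 ?expR_gt0// expRK lnV ?posrE//.
by move: (ln _) (ln _) => u v; lra.
Qed.

End finite_model.

(** The product of the two terms does not depend on [lambda], so their sum is least when they are
    equal. With [s] the square root on the right, this happens at [lambda = 4 * s / c], where each
    term is [c * s / 2]. *)
Lemma balanced_bound (R : realType) (c N l : R) : 0 < c -> 0 < N -> 0 < l ->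
  let lambda := Num.sqrt (8 * l / (c ^+ 2 * N)) in
  0 < lambda /\
  lambda * c ^+ 2 / 8 + l / (lambda * N) = c * Num.sqrt (l / (2 * N)).
Proof.
move=> c0 N0 l0 lambda.
have q0 : 0 < l / (2 * N) by rewrite divr_gt0// mulr_gt0.
set s := Num.sqrt (l / (2 * N)).
have s0 : 0 < s by rewrite sqrtr_gt0.
have ss : s ^+ 2 = l / (2 * N) by rewrite sqr_sqrtr// ltW.
have lambdaE : lambda = 4 * s / c.
  rewrite /lambda (_ : 8 * l / (c ^+ 2 * N) = (4 * s / c) ^+ 2).
    by rewrite sqrtr_sqr ger0_norm// divr_ge0 ?mulr_ge0 ?ltW.
  rewrite !exprMn ss exprVn; field.
  by rewrite !gt_eqF.
split; first by rewrite lambdaE divr_gt0 ?mulr_gt0.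
have -> : l = s ^+ 2 * (2 * N) by rewrite ss divfK// gt_eqF ?mulr_gt0.
rewrite lambdaE; field.
by rewrite !gt_eqF.
Qed.

(** * The risk bounds for general and for finite models *)

Local Open Scope ereal_scope.

Theorem theorem6p4 (R : realType) (dX dY dG dW : measure_display)
  (X : measurableType dX) (Y : measurableType dY)
  (* the elements of G are prediction functions, through predict *)
  (G : measurableType dG) (predict : G -> {mfun X >-> Y})
  (predict_inj : injective predict)
  (L : {mfun ((X * Y) * G)%type >-> R})
  (a b : R)
  (Lab : forall (z : X * Y) (g : G), (a <= L (z, g) <= b)%R)
  (P : probability (X * Y)%type R)
  (Omega : measurableType dW) (Pr : probability Omega R)
  (n : nat) (Z : 'I_n -> {mfun Omega >-> (X * Y)%type})
  (Zlaw : forall i, has_law Pr (Z i) P)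
  (Zind : mutually_independent Pr Z) :
  let Rsk := risk L P in
  let muhat lambda pi w :=
    seqrand L lambda (lambda * (b - a) ^+ 2 / 8)%R pi [tuple Z i w | i < n] in
  let avg_risk lambda pi := \int[Pr]_w \int[muhat lambda pi w]_g Rsk g in
  (forall (lambda : R) (pi : probability G R), (0 < lambda)%R ->
    let B (rho : probability G R) :=
      \int[rho]_g Rsk g + (lambda * (b - a) ^+ 2 / 8)%:E
      + KL rho pi * ((lambda * n.+1%:R)^-1)%:E in
    exists rho0 : probability G R,
      (forall rho : probability G R, B rho0 <= B rho) /\
      avg_risk lambda pi <= B rho0)
  /\
  (finite_set [set: G] ->
    let card : R := (#|` fset_set [set: G]|)%:R in
    let lambda := Num.sqrt (8 * ln card / ((b - a) ^+ 2 * n.+1%:R)) in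
    exists g0 : G,
      (forall g : G, Rsk g0 <= Rsk g) /\
      avg_risk lambda (uniform_on G R) - Rsk g0
        <= ((b - a) * Num.sqrt (ln card / (2 * n.+1%:R)))%:E).
Proof.
move=> Rsk muhat avg_risk.
split=> [lambda pi lambda0 B|finG card lambda].
  exists (gibbs pi (scaled_risk P Lab n lambda)).
  have e : B (gibbs pi (scaled_risk P Lab n lambda)) = _ :=
    bound_gibbs P Lab n pi lambda0.
  split=> [rho|]; rewrite e; first exact: optimal_bound_le.
  exact: average_risk_le.
have RskE g : Rsk g = (mean_risk L P g)%:E by exact: riskE Lab g.
have [g0 g0min] := finite_argmin finG (mean_risk L P).
exists g0; split=> [g|]; first by rewrite !RskE lee_fin.
(* Constant risk covers [a = b] (where division by zero gives [0]) and [card = 1] (where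
   [ln 1 = 0]), the cases with [lambda = 0] to which the first bound does not apply. The excess risk
   is then [0]. Otherwise [a < b] and [1 < card], hence [lambda > 0]. *)
have [cst_risk|] := pselect (forall g, mean_risk L P g = mean_risk L P g0).
  have -> : avg_risk lambda (uniform_on G R) = Rsk g0.
    rewrite /avg_risk; under eq_integral => w _.
      under eq_integral do rewrite RskE cst_risk -RskE.
      rewrite integral_cst// [X in _ * X]probability_setT mule1.
      over.
    by rewrite integral_cst// [X in _ * X]probability_setT mule1.
  have ab : (a <= b)%R by have /andP[] := Lab point point; exact: le_trans.
  rewrite RskE subee// lee_fin mulr_ge0 ?subr_ge0 ?sqrtr_ge0//.
move=> not_cst.
have ab : (a < b)%R.
  rewrite ltNge; apply/negP => ba; apply: not_cst => g.
  rewrite /mean_risk; apply: eq_Rintegral => z _.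
  have /andP[? ?] := Lab z g; have /andP[? ?] := Lab z g0; lra.
have card1 : (1 < card)%R.
  rewrite ltr1n ltnNge; apply/negP => card_le1; apply: not_cst => g.
  congr (mean_risk L P _).
  apply/eqP; move: card_le1; apply: contraTT => gg0; rewrite -ltnNge.
  have /fsubset_leq_card : ([fset g; g0] `<=` fset_set [set: G])%fset.
    by apply/fsubsetP => x _; rewrite in_fset_set// inE.
  by rewrite cardfs2 gg0.
have [] := balanced_bound (c := b - a) (N := n.+1%:R) (l := ln card).
- by rewrite subr_gt0.
- by rewrite ltr0n.
- by rewrite ln_gt0.
rewrite -/lambda => lambda0 boundE.
rewrite leeBlDr RskE//.
apply: le_trans (average_risk_le Lab Zlaw Zind _ lambda0) _.
rewrite -EFinD lee_fin -boundE /optimal_bound.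
(* At the minimizer [g0], dividing by [lambda * n.+1%:R] yields its mean risk plus the second term
   of [balanced_bound]. *)
have := partition_function_uniform_ge finG g0
  (bounded_measurable_scaled_risk P Lab n lambda).
rewrite -/card scaled_riskE => Wle.
rewrite -addrA lerD2l -mulNr ler_pdivrMr ?mulr_gt0 ?ltr0n//.
apply: (le_trans Wle); rewrite mulrDl divfK ?gt_eqF ?mulr_gt0 ?ltr0n//.
by rewrite addrC [X in (_ + X <= _)%R]mulrC.
Qed.
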